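(* $\overline{\mathscr{D}}=\overline{\mathscr{D}_{\mathrm{st}}}=\mathscr{D}+\mathbb{Z}_{\ge0}=\mathscr{D}_{\mathrm{st}}+\mathbb{Z}_{\ge0}$.
   Context: For a natural number $n$, $\|n\|$ denotes its integer complexity (the least number of $1$'s needed to write $n$ using $1$, $+$, $\cdot$ and parentheses), and $\delta(n)=\|n\|-3\log_3 n$ its defect. A natural number $n$ is stable if $\|3^kn\|=3k+\|n\|$ for all $k\ge0$. $\mathscr{D}=\{\delta(n):n\in\mathbb{N}\}$ and $\mathscr{D}_{\mathrm{st}}=\{\delta(n): n \text{ stable}\}$; overlines denote closures in $\mathbb{R}$, and $A+\mathbb{Z}_{\ge0}=\{a+m: a\in A,\ m\in\mathbb{Z}_{\ge0}\}$. *)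

(* Defs.v *)
From HB Require Import structures.
From mathcomp Require Import all_boot all_order all_algebra.
From mathcomp Require Import all_classical all_reals all_analysis.

Set Implicit Arguments.
Unset Strict Implicit.
Unset Printing Implicit Defensive.

Import Order.TTheory GRing.Theory Num.Theory.
Import numFieldNormedType.Exports.

Local Open Scope classical_set_scope.
Local Open Scope ring_scope.

Inductive expr : Type :=
| One
| Add of expr & expr
| Mul of expr & expr.

Fixpoint value (e : expr) : nat :=
  match e with
  | One => 1%N
  | Add e1 e2 => (value e1 + value e2)%N
  | Mul e1 e2 => (value e1 * value e2)%N
  end.

Fixpoint ones (e : expr) : nat :=
  match e with
  | One => 1%N
  | Add e1 e2 | Mul e1 e2 => (ones e1 + ones e2)%N
  end.

Definition writable (n k : nat) : Prop :=
  exists e : expr, value e = n /\ ones e = k.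

(* No expression has value 0, so the second disjunct only serves to make
   [complexity] total, with [complexity 0 = 0]. *)
Lemma complexity_exists (n : nat) :
  exists k, `[< writable n k \/ n = 0%N >].
Proof.
case: n => [|n]; first by exists 0%N; apply/asboolP; right.
suff [e ve] : exists e, value e = n.+1.
  by exists (ones e); apply/asboolP; left; exists e.
elim: n => [|n [e ve]]; first by exists One.
by exists (Add One e); rewrite /= ve.
Qed.

Definition complexity (n : nat) : nat := ex_minn (complexity_exists n).

Definition stable (n : nat) : Prop :=
  (0 < n)%N /\
  forall k : nat, complexity (3 ^ k * n)%N = (3 * k + complexity n)%N.

Section Defects.
Variable R : realType.

Definition defect (n : nat) : R :=
  (complexity n)%:R - 3 * (ln n%:R / ln 3).

(* The naturals here are the positive ones. *)
Definition defects : set R := [set defect n | n in [set n | (0 < n)%N]].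

Definition stable_defects : set R := [set defect n | n in stable].

Definition add_nat (A : set R) : set R :=
  [set a + m%:R | a in A & m in [set: nat]].

End Defects.
Arguments defects : clear implicits.
Arguments stable_defects : clear implicits.

(* Main.v *)
(** Multiplying by 1 shows that [D + N] is the set of all
    [k - 3 log_3 n] where [n] can be written with [k] ones.  Consider
    expressions of bounded defect along an ultrafilter.  Up to factors 3, which
    do not change the defect, such an expression is a product of two factors
    whose defects are bounded below by a positive constant, or a sum whose
    smaller summand takes finitely many values; in the latter case the larger
    summand is either constant or tends to infinity, and then has defect smaller
    by a constant.  By induction on the defect bound there are fixed [c], [k],
    [r], with [c] writable with [k] ones, such that the expression has value
    [~ c 3^j] and uses [k + r + 3 j] ones, where [r] counts the ones in the
    negligible summands (so [r = 0] means that the value is exactly [c 3^j]).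

    Hence every limit of defects is [k + r - 3 log_3 c], an element of
    [D + N].  Conversely, if [a] is stable and [3^m (3^k a + 1)] could be
    written with [|a| + 3 (k + m)] ones for arbitrarily large [k], then
    [c 3^j = 3^(k+m) a], so stability of [a] forces [r = 0] and
    [3^m (3^k a + 1) = 3^(k+m) a], which is absurd.  So [3^k a + 1] is stable of
    complexity [|a| + 3 k + 1] for large [k], and its defect tends to
    [delta(a) + 1]. *)

Require Import Defs.
From HB Require Import structures.
From mathcomp Require Import all_boot all_order all_algebra.
From mathcomp Require Import all_classical all_reals all_analysis.
From mathcomp Require Import zify ring lra.
Import Order.TTheory GRing.Theory Num.Theory.
Import numFieldNormedType.Exports.
Local Open Scope classical_set_scope.
Local Open Scope ring_scope.

Local Open Scope nat_scope.

(** * Expressions of defect zero and the gap above them *)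

Lemma ones_gt0 (e : expr) : 0 < ones e.
Proof. by elim: e => //= e1 h1 e2 h2; rewrite addn_gt0 h1. Qed.

Lemma value_gt0 (e : expr) : 0 < value e.
Proof. by elim: e => //= e1 h1 e2 h2; rewrite ?addn_gt0 ?muln_gt0 h1 ?h2. Qed.

(* [gap] says that the defect is at least [log_3 (9/8)], [exact] that it is 0. *)
Definition gap (e : expr) : Prop := 9 * value e ^ 3 <= 8 * 3 ^ ones e.

Definition exact (e : expr) : Prop :=
  exists2 j, value e = 3 ^ j.+1 & ones e = 3 * j.+1.

(* The constant 8/9 is attained at [1 + 1]. *)
Lemma sum_gap a b k l : 0 < b <= a -> 0 < k -> 0 < l ->
    a ^ 3 <= 3 ^ k -> b ^ 3 <= 3 ^ l ->
    3 <= a \/ 9 * a ^ 3 <= 8 * 3 ^ k -> 3 <= b \/ 9 * b ^ 3 <= 8 * 3 ^ l ->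
  9 * (a + b) ^ 3 <= 8 * 3 ^ (k + l) \/ a + b = 3 /\ k + l = 3.
Proof.
move=> /andP[b0 ba] k0 l0 ak bl ha hb.
have pow3 i : 0 < i -> 3 <= 3 ^ i.
  by move=> i0; rewrite -[X in X <= _](expn1 3) leq_exp2l.
have [b1|b2] : b = 1 \/ 2 <= b by lia.
  rewrite {b hb bl b0}b1 in ba *.
  have [a1|[a2|a3]] : a = 1 \/ a = 2 \/ 3 <= a by lia.
  - left; rewrite a1 (_ : 9 * _ = 8 * (3 * 3)) // leq_mul2l expnD leq_mul //; exact: pow3.
  - rewrite a2 in ak *.
    have k2 : 2 <= k by case: k k0 ak {ha} => [|[|]].
    have [[-> ->]|kl] : k = 2 /\ l = 1 \/ 4 <= k + l by lia.
      by right.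
    by left; apply: (@leq_trans (8 * 3 ^ 4)) => //; rewrite leq_mul2l leq_exp2l.
  - left; rewrite expnD.
    have h : 27 * (a + 1) ^ 3 <= 64 * a ^ 3.
      by rewrite -(expnMn 3 _ 3) -(expnMn 4 _ 3) leq_exp2r //; lia.
    apply: (@leq_trans (24 * a ^ 3)); first lia.
    have := leq_mul ak (pow3 _ l0); lia.
have step c d : 9 * c ^ 3 <= 8 * d ^ 3 -> d ^ 3 <= 3 ^ (k + l) ->
  9 * c ^ 3 <= 8 * 3 ^ (k + l) by lia.
(* From here on [a, b >= 2], so [a + b <= a * b]: a gap in either summand carries over to the
   sum. *)
left; have ab : (a + b) ^ 3 <= a ^ 3 * b ^ 3.
  rewrite -expnMn leq_exp2r //; nia.
rewrite expnD.
case: ha => [a3|ga]; last first.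
  by have := leq_mul ga bl; lia.
case: hb => [b3|gb]; last first.
  by have := leq_mul ak gb; lia.
have h : 27 * (a + b) ^ 3 <= 8 * (a ^ 3 * b ^ 3).
  rewrite -expnMn -(expnMn 3 _ 3) -(expnMn 2 _ 3) leq_exp2r //; nia.
by have := leq_mul ak bl; lia.
Qed.

(** In a product a gap in one factor survives, because the other factor has nonnegative defect. A
    sum always has a gap, except when it writes 3 with three ones. *)
Lemma exact_or_gap (e : expr) : exact e \/ gap e.
Proof.
have bound (e' : expr) : exact e' \/ gap e' -> value e' ^ 3 <= 3 ^ ones e'.
  by case=> [[j -> ->]|]; [rewrite -expnM mulnC|rewrite /gap; lia].
have side (e' : expr) : exact e' \/ gap e' -> 3 <= value e' \/ gap e'.
  case=> [[j -> _]|]; last by right.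
  by left; rewrite -[X in X <= _](expn1 3) leq_exp2l.
elim: e => [|e1 h1 e2 h2|e1 h1 e2 h2]; first by right.
- have [] : gap (Add e1 e2) \/ value (Add e1 e2) = 3 /\ ones (Add e1 e2) = 3.
    rewrite /gap /=; case: (leqP (value e2) (value e1)) => [|/ltnW] le.
      by apply: sum_gap; rewrite ?value_gt0 ?ones_gt0 ?le; auto; exact: side.
    rewrite [value e1 + _]addnC [ones e1 + _]addnC.
    by apply: sum_gap; rewrite ?value_gt0 ?ones_gt0 ?le; auto; exact: side.
  - by right.
  - by case=> v o; left; exists 0.
- have [b1 b2] := (bound _ h1, bound _ h2); rewrite /gap /exact /= expnMn expnD.
  case: h1 => [[i v1 o1]|g1]; last by right; have := leq_mul g1 b2; lia.
  case: h2 => [[j v2 o2]|g2]; last by right; have := leq_mul b1 g2; lia.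
  left; exists (i + j.+1); last by rewrite o1 o2; lia.
  by rewrite v1 v2 -expnD; congr (_ ^ _); lia.
Qed.

Lemma value_ones (e : expr) : value e ^ 3 <= 3 ^ ones e.
Proof.
by case: (exact_or_gap e) => [[j -> ->]|]; [rewrite -expnM mulnC|rewrite /gap; lia].
Qed.

(* The defect is at most [n * log_3 (9/8)]. *)
Definition low (n : nat) (e : expr) : Prop :=
  3 ^ ones e * 8 ^ n <= 9 ^ n * value e ^ 3.

(** * Decomposition of expressions up to powers of 3 *)

Variant shape (e : expr) (i : nat) (e1 e2 : expr) : Prop :=
| ShapeExact of exact e
| ShapeOne of value e = 3 ^ i & ones e = 1 + 3 * i
| ShapeAdd of value e2 <= value e1 & value e = 3 ^ i * (value e1 + value e2)
    & ones e = ones e1 + ones e2 + 3 * i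
| ShapeMul of gap e1 & gap e2 & value e = 3 ^ i * (value e1 * value e2)
    & ones e = ones e1 + ones e2 + 3 * i.

(** A product with an exact factor inherits the shape of its other factor, the exact one being
    absorbed into [3 ^ i]. *)
Lemma shapeP (e : expr) : exists i e1 e2, shape e i e1 e2.
Proof.
elim: e => [|e1 _ e2 _|e1 h1 e2 h2].
- by exists 0, One, One; apply: ShapeOne.
- case: (leqP (value e2) (value e1)) => [|/ltnW] le.
    by exists 0, e1, e2; apply: ShapeAdd => //=; lia.
  by exists 0, e2, e1; apply: ShapeAdd => //=; lia.
have main (e' : expr) f : gap e' -> exact f -> (exists i e1 e2, shape e' i e1 e2) ->
    value (Mul e1 e2) = value e' * value f -> ones (Mul e1 e2) = ones e' + ones f ->
    exists i a b, shape (Mul e1 e2) i a b.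
  move=> ge [j vf of_] [i [a [b sh]]]; rewrite vf of_ => vE oE.
  exists (i + j.+1), a, b; case: sh vE oE.
  - move=> [k vk ok] vE oE; exfalso; move: ge; rewrite /gap vk ok -expnM [k.+1 * 3]mulnC.
    by have := expn_gt0 3 (3 * k.+1); lia.
  - move=> v o vE oE; apply: ShapeOne; rewrite ?vE ?oE ?v ?o ?expnD //; lia.
  - by move=> le v o vE oE; apply: ShapeAdd; rewrite ?vE ?oE ?v ?o ?expnD //; lia.
  - by move=> ga gb v o vE oE; apply: ShapeMul; rewrite ?vE ?oE ?v ?o ?expnD //; lia.
case: (exact_or_gap e1) => [x1|g1]; case: (exact_or_gap e2) => [x2|g2].
- exists 0, One, One; apply: ShapeExact; case: x1 x2 => i v1 o1 [j v2 o2].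
  exists (i + j.+1); rewrite /= ?v1 ?v2 ?o1 ?o2; last lia.
  by rewrite -expnD; congr (_ ^ _); lia.
- by apply: (main e2 e1) => //=; lia.
- exact: (main e1 e2).
- by exists 0, e1, e2; apply: ShapeMul => //=; lia.
Qed.

(** * Approximation by a leading term [c * 3 ^ j] *)

(* The value is [c * 3 ^ j] up to a factor [1 + 1 / M]. *)
Definition nearly (c k r M : nat) (e : expr) : Prop :=
  exists j, [/\ ones e = k + r + 3 * j, c * 3 ^ j <= value e,
    M * value e <= M.+1 * (c * 3 ^ j) & r = 0 -> value e = c * 3 ^ j].

Lemma nearly_shift c k r M i e' e : value e = 3 ^ i * value e' ->
  ones e = ones e' + 3 * i -> nearly c k r M e' -> nearly c k r M e.
Proof.
move=> ve oe [j [eqo lo hi r0]]; exists (i + j).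
have -> : c * 3 ^ (i + j) = 3 ^ i * (c * 3 ^ j) by rewrite expnD mulnCA.
split; rewrite ?oe ?ve.
- by rewrite eqo; lia.
- by rewrite leq_mul2l lo orbT.
- by rewrite mulnCA [X in _ <= X]mulnCA leq_mul2l hi orbT.
- by move=> /r0 ->.
Qed.

(** Relative errors multiply, and [4 * M * M.+1 <= (2 * M + 1) ^ 2] says that two errors
    [1 / (2 * M + 1)] combine to at most [1 / M]. *)
Lemma nearly_mul c1 k1 r1 c2 k2 r2 M e1 e2 :
    nearly c1 k1 r1 (2 * M + 1) e1 -> nearly c2 k2 r2 (2 * M + 1) e2 ->
  nearly (c1 * c2) (k1 + k2) (r1 + r2) M (Mul e1 e2).
Proof.
move=> [i [q1 l1 h1 z1]] [j [q2 l2 h2 z2]]; exists (i + j) => /=.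
have -> : c1 * c2 * 3 ^ (i + j) = (c1 * 3 ^ i) * (c2 * 3 ^ j).
  by rewrite expnD mulnACA.
move: (c1 * 3 ^ i) (c2 * 3 ^ j) l1 h1 z1 l2 h2 z2 => X Y l1 h1 z1 l2 h2 z2.
split; [by rewrite q1 q2; lia|exact: leq_mul| |].
  rewrite -(@leq_pmul2l (4 * M.+1)) //; move: (leq_mul h1 h2); nia.
by move=> /eqP; rewrite addn_eq0 => /andP[/eqP/z1 -> /eqP/z2 ->].
Qed.

(** Dropping [e2] is a second relative error of [1 / (2 * M + 1)]; its ones move into [r], which
    thereby becomes positive. *)
Lemma nearly_add c k r M e1 e2 : (2 * M + 1) * value e2 <= value e1 ->
  nearly c k r (2 * M + 1) e1 -> nearly c k (r + ones e2) M (Add e1 e2).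
Proof.
move=> small [j [eqo lo hi _]]; exists j => /=; split.
- by rewrite eqo; lia.
- exact: leq_trans lo (leq_addr _ _).
- move: (c * 3 ^ j) lo hi => X lo hi.
  rewrite -(@leq_pmul2l (4 * M.+1)) //; nia.
- by have := ones_gt0 e2; lia.
Qed.

(** Defects add up over products, and the gap of [e2] takes one unit [log_3 (9/8)] of the budget. *)
Lemma low_factor n e e1 e2 i : gap e2 -> value e = 3 ^ i * (value e1 * value e2) ->
  ones e = ones e1 + ones e2 + 3 * i -> low n.+1 e -> low n e1.
Proof.
rewrite /gap /low => g2 -> ->.
rewrite !expnMn -expnM [i * 3]mulnC 2!expnD [8 ^ _]expnS [9 ^ _]expnS.
have v0 : 0 < value e2 ^ 3 by rewrite expn_gt0 value_gt0.
have X0 : 0 < 3 ^ (3 * i) by rewrite expn_gt0.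
move: (3 ^ (3 * i)) (3 ^ ones e1) (3 ^ ones e2) (8 ^ n) (9 ^ n) X0 g2 v0.
move: (value e1 ^ 3) (value e2 ^ 3) => V1 V2 X C D A B X0 g2 v0 h.
have h1 : C * D * (8 * A) <= 9 * B * (V1 * V2).
  by rewrite -(leq_pmul2l X0); lia.
have h2 : B * V1 * (9 * V2) <= B * V1 * (8 * D) by rewrite leq_mul2l g2 orbT.
have D0 : 0 < 8 * D by lia.
by rewrite -(leq_pmul2l D0); lia.
Qed.

(** * Expressions of bounded defect along an ultrafilter *)

Lemma ultra_or {T} {U : set_system T} (UU : UltraFilter U) (A B : set T) :
  U (A `|` B) -> U A \/ U B.
Proof.
move=> UAB; case: (in_ultra_setVsetC A UU) => [|UnA]; first by left.
by right; apply: filterS (filterI UAB UnA) => t [[]].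
Qed.

Lemma ultra_bounded {T} {U : set_system T} (UU : UltraFilter U) (g : T -> nat) B :
  U [set t | g t <= B] -> exists b, U [set t | g t = b].
Proof.
elim: B => [|B IH] UB.
  by exists 0; apply: filterS UB => t /=; rewrite leqn0 => /eqP.
have /(ultra_or UU)[/IH//|UgB] : U ([set t | g t <= B] `|` [set t | g t = B.+1]).
  by apply: filterS UB => t /=; rewrite leq_eqVlt ltnS => /orP[/eqP|]; [right|left].
by exists B.+1.
Qed.

(* Along an ultrafilter each summand is either constant, and then belongs to
   [c] or is counted by [r], or it tends to infinity and is cut off by the
   recursion. *)
Lemma ultra_nearly {T} {U : set_system T} (UU : UltraFilter U) n (f : T -> expr) :
    U [set t | low n (f t)] ->
  exists c k r, writable c k /\ forall M, U [set t | nearly c k r M (f t)].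
Proof.
have const g c k : U [set t | value (g t) = c /\ ones (g t) = k] ->
    exists c k r, writable c k /\ forall M, U [set t | nearly c k r M (g t)].
  move=> Uck; exists c, k, 0; split.
    by have [t [v o]] := filter_ex Uck; exists (g t).
  move=> M; apply: filterS Uck => t /= [v o]; exists 0.
  by rewrite v o expn0 muln1; split=> //; lia.
elim: n f => [|n IH] f Uf.
  have exf : U [set t | exact (f t)].
    apply: filterS Uf => t /=; rewrite /low !expn0; case: (exact_or_gap (f t)) => //.
    by rewrite /gap; have := expn_gt0 3 (ones (f t)); lia.
  (* The leading coefficient is 3 and not 1, since 1 cannot be written with zero ones. *)
  exists 3, 3, 0; split; first by exists (Add One (Add One One)).
  move=> M; apply: filterS exf => t /= [j v o]; exists j.
  by rewrite v o expnS; split=> //; lia.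
have /choice[g gP] t : exists p : nat * expr * expr, shape (f t) p.1.1 p.1.2 p.2.
  by have [i [a [b sh]]] := shapeP (f t); exists (i, a, b).
pose i t := (g t).1.1; pose a t := (g t).1.2; pose b t := (g t).2.
have {gP} : U ([set t | exact (f t)] `|`
    [set t | value (f t) = 3 ^ i t /\ ones (f t) = 1 + 3 * i t] `|`
    [set t | [/\ value (b t) <= value (a t),
                 value (f t) = 3 ^ i t * (value (a t) + value (b t))
               & ones (f t) = ones (a t) + ones (b t) + 3 * i t]] `|`
    [set t | [/\ gap (a t), gap (b t),
                 value (f t) = 3 ^ i t * (value (a t) * value (b t))
               & ones (f t) = ones (a t) + ones (b t) + 3 * i t]]).
  apply: filterS filterT => t _; rewrite /i /a /b; by case: (gP t) => *;
    [left; left; left|left; left; right|left; right|right].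
move=> /(ultra_or UU)[/(ultra_or UU)[/(ultra_or UU)[]|]|] Ush.
- exists 3, 3, 0; split; first by exists (Add One (Add One One)).
  move=> M; apply: filterS Ush => t /= [j v o]; exists j.
  by rewrite v o expnS; split=> //; lia.
- exists 1, 1, 0; split; first by exists One.
  move=> M; apply: filterS Ush => t /= [v o]; exists (i t).
  by rewrite v o mul1n; split=> //; lia.
- have {}Ush : U [set t | [/\ value (b t) <= value (a t),
     value (f t) = 3 ^ i t * (value (a t) + value (b t)),
     ones (f t) = ones (a t) + ones (b t) + 3 * i t
   & 3 ^ (ones (a t) + ones (b t)) * 8 ^ n.+1
       <= 9 ^ n.+1 * (value (a t) + value (b t)) ^ 3]].
    apply: filterS (filterI Uf Ush) => t /= [lowf [le v o]]; split=> //.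
    move: lowf; rewrite /low v o expnMn -expnM [i t * 3]mulnC.
    rewrite [3 ^ (_ + 3 * _)]expnD.
    have := expn_gt0 3 (3 * i t); move: (3 ^ (3 * _)) (8 ^ _) (9 ^ _) => X Y Z X0 h.
    by rewrite -(leq_pmul2l X0); nia.
  have e8 m : 3 ^ m <= 9 ^ n.+1 * 8 -> m <= 9 ^ n.+1 * 8.
    by move=> h; apply: leq_trans h; apply/ltnW; rewrite ltn_expl.
  (* The sum is at most twice [value (a t)], whose cube is at most [3 ^ ones (a t)]; cancelling this
     power bounds [3 ^ ones (b t)]. *)
  have [l Ul] : exists l, U [set t | ones (b t) = l].
    apply: (ultra_bounded UU _ ( 9 ^ n.+1 * 8)).
    apply: filterS Ush => t /= [le _ _ h]; apply: e8.
    have := expn_gt0 8 n.+1; have := value_ones (a t); have := expn_gt0 3 (ones (b t)).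
    have v0 := value_gt0 (a t).
    have : (value (a t) + value (b t)) ^ 3 <= 8 * value (a t) ^ 3.
      by rewrite -(expnMn 2 _ 3) leq_exp2r //; lia.
    move: h; rewrite expnD.
    have : 0 < value (a t) ^ 3 by rewrite expn_gt0 v0.
    move: (8 ^ _) (9 ^ _) (3 ^ ones (a t)) (3 ^ ones (b t)) (value (a t) ^ 3).
    move=> A B C D E E0 h1 h2 D0 EC A0.
    have h3 : C * D <= C * (B * 8) by nia.
    by rewrite -(@leq_pmul2l C) //; lia.
  have [w Uw] : exists w, U [set t | value (b t) = w].
    apply: (ultra_bounded UU _ ( 3 ^ l)).
    apply: filterS Ul => t /= <-; apply: leq_trans (value_ones (b t)).
    by rewrite -[X in X <= _]expn1 leq_pexp2l // value_gt0.
  have [[A UA]|unbounded] := EM (exists A, U [set t | value (a t) <= A]).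
    have [v Uv] := ultra_bounded UU _ A UA.
    have [k Uk] : exists k, U [set t | ones (a t) = k].
      apply: (ultra_bounded UU _ (9 ^ n.+1 * (v + w) ^ 3)).
      apply: filterS (filterI Ush (filterI Uv Uw)) => t /= [[_ _ _ h] [va wb]].
      rewrite va wb in h; apply: leq_trans h; rewrite expnD -mulnA.
      apply: leq_trans (leq_pmulr _ _); first exact/ltnW/ltn_expl.
      by rewrite muln_gt0 !expn_gt0.
    have [|c [k' [r [wr A']]]] := const (fun t => Add (a t) (b t)) (v + w) (k + l).
      by apply: filterS (filterI (filterI Uv Uw) (filterI Uk Ul)) => t /= [[-> ->] [-> ->]].
    exists c, k', r; split=> // M; apply: filterS (filterI Ush (A' M)).
    by move=> t /= [[_ v' o' _]]; exact: (nearly_shift _ _ _ _ _ (Add _ _) _ v' o').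
  have big B : U [set t | B <= value (a t)].
    have [UB|] := in_ultra_setVsetC [set t | value (a t) <= B] UU.
      by case: unbounded; exists B.
    by apply: filterS => t /= /negP; rewrite -ltnNge => /ltnW.
  (* Once [value (a t) >= 3 * w], adding [b t] multiplies the cubed value by at most 64/27 but the
     power of 3 by at least 3. As 81/64 >= 9/8, the defect of [a t] is lower by a whole unit. *)
  have /IH[c [k [r [wr Ua]]]] : U [set t | low n (a t)].
    apply: filterS (filterI Ush (filterI Uw (big (3 * w)))) => t /= [[_ _ _ h] [wb ba]].
    have : 27 * (value (a t) + value (b t)) ^ 3 <= 64 * value (a t) ^ 3.
      by rewrite -(expnMn 3 _ 3) -(expnMn 4 _ 3) leq_exp2r //; lia.
    have : 3 <= 3 ^ ones (b t).
      by rewrite -[X in X <= _](expn1 3) leq_exp2l // ones_gt0.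
    move: h; rewrite /low expnD [8 ^ _]expnS [9 ^ _]expnS.
    move: (8 ^ n) (9 ^ n) (3 ^ ones (a t)) (3 ^ ones (b t)) ((_ + _) ^ 3) (value _ ^ 3)
      => A B C D E F h D3 EF.
    have : 3 * (C * A) <= C * D * A by nia.
    have : B * (27 * E) <= B * (64 * F) by rewrite leq_mul2l EF orbT.
    nia.
  exists c, k, (r + l); split=> // M.
  apply: filterS (filterI (filterI Ush (Ua (2 * M + 1)))
    (filterI (filterI Ul Uw) (big ((2 * M + 1) * w)))).
  move=> t /= [[[_ v o _] ap] [[lb wb] ba]].
  apply: (nearly_shift _ _ _ _ _ (Add (a t) (b t)) _ v o).
  by rewrite -lb; apply: nearly_add ap; rewrite wb.
- have [c1 [k1 [r1 [w1 A1]]]] : exists c k r,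
      writable c k /\ forall M, U [set t | nearly c k r M (a t)].
    apply: IH; apply: filterS (filterI Uf Ush) => t /= [lowf [_ gb v o]].
    exact: low_factor gb v o lowf.
  have [c2 [k2 [r2 [w2 A2]]]] : exists c k r,
      writable c k /\ forall M, U [set t | nearly c k r M (b t)].
    apply: IH; apply: filterS (filterI Uf Ush) => t /= [lowf [ga _ v o]].
    apply: (low_factor _ (f t) _ (a t) (i t)) => //; first by rewrite v [value (a t) * _]mulnC.
    by rewrite o [ones (a t) + _]addnC.
  exists (c1 * c2), (k1 + k2), (r1 + r2); split.
    by case: w1 w2 => [x [<- <-]] [y [<- <-]]; exists (Mul x y).
  move=> M; apply: filterS (filterI Ush (filterI (A1 (2 * M + 1)) (A2 (2 * M + 1)))).
  move=> t /= [[_ _ v o] [h1 h2]].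
  exact: (nearly_shift _ _ _ _ _ (Mul _ _) _ v o
    (nearly_mul _ _ _ _ _ _ _ _ _ h1 h2)).
Qed.

(** * Complexity under multiplication by powers of 3 *)

Lemma complexity_expr n : 0 < n -> exists2 e, value e = n & ones e = complexity n.
Proof.
rewrite /complexity; case: ex_minnP => k /asboolP[[e [v o]] _ _|->//].
by exists e.
Qed.

Lemma complexity_le n k : writable n k -> complexity n <= k.
Proof. by rewrite /complexity; case: ex_minnP => m _ mn w; apply: mn; apply/asboolP; left. Qed.

Lemma writable_complexity n : 0 < n -> writable n (complexity n).
Proof. by case/complexity_expr => e v o; exists e. Qed.

Lemma writable_gt0 n k : writable n k -> 0 < n.
Proof. by case=> e [<- _]; apply: value_gt0. Qed.

Lemma writable_expn3 n k i : writable n k -> writable (3 ^ i * n) (3 * i + k).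
Proof.
move=> w; elim: i => [|i [e [v o]]]; first by rewrite mul1n.
by exists (Mul (Add One (Add One One)) e); rewrite /= v o expnS; split; lia.
Qed.

Lemma complexity_expn3_le n i : 0 < n -> complexity (3 ^ i * n) <= 3 * i + complexity n.
Proof. by move=> n0; apply/complexity_le/writable_expn3/writable_complexity. Qed.

(* The defect drops by an integer whenever [3 ^ i * n] is not stable, and it
   stays nonnegative. *)
Lemma stable_expn3 n : 0 < n -> exists i, stable (3 ^ i * n).
Proof.
move=> n0; pose P g := `[< exists i, complexity (3 ^ i * n) + g = 3 * i + complexity n >].
have P0 : exists g, P g by exists 0; apply/asboolP; exists 0; rewrite mul1n addn0.
have Pmax g : P g -> g <= complexity n.
  move=> /asboolP[i eqg].
  have [|e v o] := @complexity_expr (3 ^ i * n); first by rewrite muln_gt0 expn_gt0.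
  have : 3 ^ (3 * i) <= 3 ^ ones e.
    apply: leq_trans (value_ones e); rewrite mulnC expnM leq_exp2r // v.
    by rewrite leq_pmulr.
  by rewrite leq_exp2l // o; lia.
case: (ex_maxnP P0 Pmax) => g /asboolP[i eqg] gmax; exists i.
split; first by rewrite muln_gt0 expn_gt0.
move=> k; apply/eqP; rewrite eqn_leq complexity_expn3_le ?muln_gt0 ?expn_gt0 //=.
rewrite mulnA -expnD.
have le := @complexity_expn3_le n (k + i) n0.
have /gmax : P (3 * (k + i) + complexity n - complexity (3 ^ (k + i) * n)).
  by apply/asboolP; exists (k + i); lia.
lia.
Qed.

(** * Stability of [3 ^ k * a + 1] for large [k] *)

(** Bernoulli's inequality for [9 / 8]; it turns any bound on defects into some [low n]. *)
Lemma pow_9_8_unbounded C : exists n, C * 8 ^ n <= 9 ^ n.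
Proof.
have bern n : (n + 8) * 8 ^ n <= 8 * 9 ^ n.
  by elim: n => // n; rewrite !expnS; move: (8 ^ n) (9 ^ n) => A B; nia.
by exists (8 * C); have := bern (8 * C); nia.
Qed.

(** Divided by the smaller of [3 ^ j] and [3 ^ (m + k)], both leading terms are integers, which a
    relative error [1 / M] with [M > a + c] is too small to separate. *)
Lemma near_power3_eq a c j k m M :
    0 < a -> a + c < M -> c < k ->
    c * 3 ^ j <= 3 ^ m * (3 ^ k * a + 1) ->
    M * (3 ^ m * (3 ^ k * a + 1)) <= M.+1 * (c * 3 ^ j) ->
  c * 3 ^ j = 3 ^ (m + k) * a.
Proof.
move=> a0 Mac ck.
have ck3 : c < 3 ^ k by apply: (ltn_trans ck); rewrite ltn_expl.
have k3 : 3 <= 3 ^ k by rewrite -[X in X <= _](expn1 3) leq_exp2l //; lia.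
have m0 : 0 < 3 ^ m by rewrite expn_gt0.
case: (leqP (m + k) j) => [/subnKC <-|/ltnW jmk].
  rewrite !expnD; set q := 3 ^ (j - _).
  move: (3 ^ m) (3 ^ k) m0 k3 {ck3} => X Y X0 ck3 h1 h2.
  have {}h1 : c * q <= a.
    have : X * (Y * (c * q)) <= X * (Y * a + 1) by lia.
    rewrite leq_pmul2l // => h.
    nia.
  have {}h2 : M * a <= M.+1 * (c * q).
    have : X * Y * (M * a) <= X * Y * (M.+1 * (c * q)) by lia.
    by rewrite leq_pmul2l ?muln_gt0 ?X0 ?(ltnW (ltnW ck3)).
  have -> : c * (X * Y * q) = X * Y * (c * q) by lia.
  congr (_ * _); nia.
pose d := m + k - j => h1 h2.
have eqN : 3 ^ m * (3 ^ k * a) = 3 ^ j * (3 ^ d * a).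
  by rewrite !mulnA -!expnD /d; congr (3 ^ _ * a); lia.
rewrite -(subnKC jmk) expnD -mulnA mulnC -/d; congr (_ * _).
move: (3 ^ m) (3 ^ k) (3 ^ j) (3 ^ d * a) m0 ck3 h1 h2 eqN (expn_gt0 3 j).
move=> Z Y X q Z0 cY h1 h2 eqN /= X0.
have qc : q <= c.
  have : X * (M * q) <= X * (M.+1 * c) by nia.
  by rewrite leq_pmul2l // => h; nia.
(* If [q < c], the extra [3 ^ m] has to make up the difference, so [3 ^ j <= 3 ^ m]; then
   [q >= 3 ^ k > c]. *)
apply/eqP; rewrite eqn_leq qc andbT leqNgt; apply/negP => ltqc.
have XZ : X <= Z by nia.
have ZY : Z * Y <= Z * q by nia.
by move: ZY; rewrite leq_pmul2l //; lia.
Qed.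

(* If infinitely many of these numbers had smaller complexity, optimal
   expressions for them would be governed by one leading term [c * 3 ^ j];
   size forces [c * 3 ^ j = 3 ^ (m + k) * a], and stability of [a] then leaves
   no room for the correction [r]. *)
Lemma complexity_succ_eventually a : stable a ->
  exists K, forall k m, K <= k ->
    complexity a + 3 * (m + k) < complexity (3 ^ m * (3 ^ k * a + 1)).
Proof.
move=> [a0 sta]; apply: contrapT => noK.
have /choice[f fP] K : exists p : nat * nat * expr, [/\ K <= p.1.1,
    value p.2 = 3 ^ p.1.2 * (3 ^ p.1.1 * a + 1)
  & ones p.2 <= complexity a + 3 * (p.1.2 + p.1.1)].
  apply: contrapT => none; apply: noK; exists K => k m Kk.
  rewrite ltnNge; apply/negP => le; apply: none.
  have [|e v o] := @complexity_expr (3 ^ m * (3 ^ k * a + 1)).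
    by rewrite muln_gt0 expn_gt0 addn1.
  by exists (k, m, e); rewrite /= o.
pose k t := (f t).1.1; pose m t := (f t).1.2; pose e t := (f t).2.
have [U [UU coU]] := ultraFilterLemma (F := \oo) _.
(* The values exceed [3 ^ (m + k)], so the defects are at most [complexity a]. *)
have [n Hn] := pow_9_8_unbounded (3 ^ complexity a).
have lowe : U [set t | low n (e t)].
  apply: filterS filterT => t _ /=; have [_ v o] := fP t; rewrite /low /e v.
  move: (f t).1.1 (f t).1.2 v o => k' m' v o.
  have h : 3 ^ ones (f t).2 <= 3 ^ complexity a * (3 ^ (m' + k')) ^ 3.
    by rewrite -expnM -expnD leq_exp2l //; lia.
  have h' : (3 ^ (m' + k')) ^ 3 <= (3 ^ m' * (3 ^ k' * a + 1)) ^ 3.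
    by rewrite leq_exp2r // expnD leq_mul2l; nia.
  have := leq_mul Hn h'; have := leq_mul h (leqnn (8 ^ n)); lia.
have [c [kc [r [w ap]]]] := ultra_nearly UU n e lowe.
have Uk : U [set t | c < k t].
  apply: coU; exists c.+1 => // t /= ct; have [kt _ _] := fP t.
  exact: leq_trans ct kt.
have [t /= [[j [q lo hi z]] ck]] := filter_ex (filterI (ap (a + c).+1) Uk).
have [_ v le] := fP t; rewrite -/(e t) -/(k t) -/(m t) in v le.
rewrite v in lo hi z.
have eqX := near_power3_eq _ _ _ _ _ _ a0 (ltnSn _) ck lo hi.
have := complexity_le _ _ (writable_expn3 _ _ j w).
rewrite mulnC eqX sta => le'.
have /z : r = 0 by lia.
rewrite eqX expnD mulnDr mulnA muln1 => /eqP.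
by rewrite -[X in _ == X]addn0 eqn_add2l -leqn0 leqNgt expn_gt0.
Qed.

Lemma complexity_succ_le a k : 0 < a -> complexity (3 ^ k * a + 1) <= complexity a + 3 * k + 1.
Proof.
move=> a0; have [e [v o]] := writable_expn3 _ _ k (writable_complexity _ a0).
by apply: complexity_le; exists (Add e One); rewrite /= v o; split; lia.
Qed.

(** The lower bound, uniform in [m], meets the obvious upper bound at [m = 0] and for every further
    factor [3 ^ m]. *)
Lemma stable_succ_eventually a : stable a -> exists K, forall k, K <= k ->
  stable (3 ^ k * a + 1) /\ complexity (3 ^ k * a + 1) = complexity a + 3 * k + 1.
Proof.
move=> sta; have [K KP] := complexity_succ_eventually _ sta; exists K => k Kk.
have up := complexity_succ_le _ k sta.1.
have := KP k 0 Kk; rewrite mul1n => low0.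
split; last by lia.
split=> [|m]; first by rewrite addn1.
have := complexity_expn3_le (3 ^ k * a + 1) m; rewrite addn1 => /(_ isT).
by have := KP k m Kk; rewrite !addn1 in up *; lia.
Qed.

(** * Limits of defects in the reals *)

Local Open Scope ring_scope.

Section RealDefects.
Variable R : realType.
Implicit Types x y : R.

Lemma closure_epsP (A : set R) x :
  closure A x <-> forall e, 0 < e -> exists2 y, A y & `|x - y| < e.
Proof.
split=> [cl e e0|h B].
  by have [y [Ay /= xy]] := cl _ (nbhsx_ballx x e e0); exists y.
move=> /nbhs_ballP[e /= e0 eB]; have [y Ay xy] := h _ e0.
by exists y; split=> //; apply: eB.
Qed.

(** The defect of a single expression with value [c] and [k] ones, whether or not it is optimal. *)
Definition level (c k : nat) : R := k%:R - 3 * (ln c%:R / ln 3).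

Let ln3 : 0 < ln 3 :> R.
Proof. by rewrite ln_gt0 // ltr1n. Qed.

Let ln3_neq0 : ln 3 != 0 :> R.
Proof. by rewrite gt_eqF. Qed.

Lemma level_expn3 (c k j : nat) : (0 < c)%N -> level (3 ^ j * c) (3 * j + k) = level c k.
Proof.
move=> c0; rewrite /level natrM natrX lnM ?posrE ?exprn_gt0 ?ltr0n //.
rewrite lnXn ?ltr0n // -mulr_natr natrD natrM.
by field; rewrite gt_eqF.
Qed.

(** The bound comes from [ln (1 + 1 / M) <= 1 / M]. *)
Lemma level_nearly (c k r M : nat) (e : expr) : (0 < c)%N -> (0 < M)%N -> nearly c k r M e ->
  `|level c (k + r) - level (value e) (ones e)| <= 3 / ln 3 / M%:R.
Proof.
move=> c0 M0 [j [q lo hi _]].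
rewrite -(level_expn3 _ _ j c0) {1}addnC -q mulnC /level; set X := (c * 3 ^ j)%N in lo hi *.
have X0 : 0 < X%:R :> R by rewrite ltr0n /X muln_gt0 c0 expn_gt0.
have v0 : 0 < (value e)%:R :> R by rewrite ltr0n value_gt0.
have le1 : 0 <= ln (value e)%:R - ln X%:R :> R.
  by rewrite subr_ge0 ler_ln ?posrE // ler_nat.
have le2 : ln (value e)%:R - ln X%:R <= M%:R^-1 :> R.
  have M1 : 0 < M%:R^-1 :> R by rewrite invr_gt0 ltr0n.
  apply: le_trans (le_ln1Dx _); last by apply: lt_trans M1; rewrite ltrN10.
  rewrite -ln_div ?posrE // ler_ln ?posrE ?divr_gt0 ?addr_gt0 //.
  rewrite ler_pdivrMr // -(@ler_pM2l _ M%:R) ?ltr0n //.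
  have -> : M%:R * ((1 + M%:R^-1) * X%:R) = M.+1%:R * X%:R :> R.
    by rewrite -natr1; field; rewrite gt_eqF // ltr0n.
  by rewrite -!natrM ler_nat.
have -> : (ones e)%:R - 3 * (ln X%:R / ln 3) -
    ((ones e)%:R - 3 * (ln (value e)%:R / ln 3)) =
  3 / ln 3 * (ln (value e)%:R - ln X%:R) :> R by field; rewrite gt_eqF.
rewrite ger0_norm; last by rewrite mulr_ge0 // divr_ge0 // ltW.
by rewrite ler_wpM2l // divr_ge0 // ltW.
Qed.

Lemma small_error (C e : R) : 0 < e -> exists2 M, (0 < M)%N & C / M%:R < e.
Proof.
move=> e0; exists (Num.truncn (`|C| / e)).+1 => //.
rewrite ltr_pdivrMr ?ltr0n // mulrC -ltr_pdivrMr //.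
apply: le_lt_trans (truncnS_gt _); rewrite ler_pM2r ?invr_gt0 //; exact: ler_norm.
Qed.

Lemma level_add_nat (c k : nat) : writable c k -> add_nat (defects R) (level c k).
Proof.
move=> w; have c0 := writable_gt0 _ _ w; have le := complexity_le _ _ w.
exists (defect R c); first by exists c.
exists (k - complexity c)%N => //.
by rewrite /defect /level natrB //; ring.
Qed.

(** Passing from [n] to a stable [3 ^ i * n] lowers the defect by a natural number, which is moved
    into the integer summand. *)
Lemma stable_add_nat : add_nat (defects R) = add_nat (stable_defects R).
Proof.
apply/seteqP; split=> x [y [n n0 <-]] [m _ <-]; last first.
  by exists (defect R n); [exists n => //; exact: n0.1|exists m].
have [i st] := stable_expn3 _ n0.
exists (defect R (3 ^ i * n)); first by exists (3 ^ i * n)%N.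
have le := complexity_expn3_le n i n0.
exists (3 * i + complexity n - complexity (3 ^ i * n) + m)%N => //.
rewrite -(level_expn3 n (complexity n) i n0 : _ = defect R n).
by rewrite /defect /level natrD natrB //; ring.
Qed.

Lemma closure_defects_sub : closure (defects R) `<=` add_nat (defects R).
Proof.
move=> x /closure_epsP clx.
have /choice[f fP] t : exists e : expr, `|x - level (value e) (ones e)| < t.+1%:R^-1.
  have [|y [n n0 <-] xn] := clx t.+1%:R^-1; first by rewrite invr_gt0 ltr0n.
  by have [e v o] := complexity_expr _ n0; exists e; rewrite v o.
have [U [UU coU]] := ultraFilterLemma (F := \oo) _.
(* The chosen defects lie within 1 of [x], hence below [B]. *)
pose B := (Num.truncn (`|x| + 1)).+1.
have [n Hn] := pow_9_8_unbounded (3 ^ B).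
have lowf : U [set t | low n (f t)].
  apply: filterS filterT => t _ /=; rewrite /low.
  have h : (3 ^ ones (f t) <= 3 ^ B * value (f t) ^ 3)%N.
    have v0 : 0 < (value (f t))%:R :> R by rewrite ltr0n value_gt0.
    rewrite -(ler_nat R) natrM !natrX -ler_ln ?posrE ?mulr_gt0 ?exprn_gt0 //.
    rewrite lnM ?posrE ?exprn_gt0 // !lnXn //.
    have xB : `|x| + 1 < B%:R by exact: truncnS_gt.
    have t1 : t.+1%:R^-1 <= 1 :> R by rewrite invf_le1 ?ltr0n // ler1n.
    have := fP t; rewrite ltr_distlC => /andP[_ xl]; have xn := ler_norm x.
    rewrite -[X in _ <= _ + X *+ 3](divfK ln3_neq0).
    rewrite -[X in X <= _]mulr_natr -[X in _ <= X + _]mulr_natr.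
    rewrite -[X in _ <= _ + X]mulr_natr.
    move: xl; rewrite /level; move: (ln (value _)%:R / ln 3) => z xl.
    have : (ones (f t))%:R <= B%:R + 3 * z.
      by move: (B%:R) (`|x|) (t.+1%:R^-1) xB xn t1 xl => b n' t'; lra.
    by rewrite -(ler_pM2l ln3); lra.
  have := leq_mul h (leqnn (8 ^ n)).
  by move/leq_trans; apply; rewrite mulnAC leq_mul2r Hn orbT.
have [c [k [r [w ap]]]] := ultra_nearly UU n f lowf.
have c0 := writable_gt0 _ _ w.
(* Multiplying by 1 spends the [r] extra ones without changing the value. *)
have wr : writable c (k + r).
  have [e [v eo]] := w; elim: r {ap} => [|r [e' [v' o']]]; first by rewrite addn0.
  by exists (Mul One e'); rewrite /= v' o' mul1n addnS.
suff -> : x = level c (k + r) by exact: level_add_nat.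
apply/eqP; rewrite -subr_eq0 -normr_le0; apply/ler_addgt0Pl => e e0; rewrite addr0.
have e20 : 0 < e / 2 by rewrite divr_gt0.
have [M M0 hM] := small_error (3 / ln 3) _ e20.
have [K K0 hK] := small_error 1 _ e20.
have UK : U [set t | (K <= t)%N] by apply: coU; exists K.
have [t /= [apt Kt]] := filter_ex (filterI (ap M) UK).
have h1 := level_nearly _ _ _ _ _ c0 M0 apt.
have h2 : t.+1%:R^-1 <= 1 / K%:R :> R.
  by rewrite div1r lef_pV2 ?posrE ?ltr0n // ler_nat ltnW.
apply: le_trans (ler_distD (level (value (f t)) (ones (f t))) _ _) _.
rewrite [e]splitr lerD //; last by rewrite distrC (le_trans h1) // ltW.
by rewrite (le_trans (ltW (fP t))) // (le_trans h2) // ltW.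
Qed.

(** One unit of [m] is traded for replacing [a] by the stable number [3 ^ k * a + 1], whose defect
    tends to [defect R a + 1]. *)
Lemma stable_defect_addn (a m : nat) : stable a ->
  closure (stable_defects R) (defect R a + m%:R).
Proof.
elim: m a => [|m IH] a st; first by apply: subset_closure; exists a => //; rewrite addr0.
apply/closure_epsP => e e0; have e20 : 0 < e / 2 by rewrite divr_gt0.
have [K KP] := stable_succ_eventually _ st.
have [M M0 hM] := small_error (3 / ln 3) _ e20.
(* Taking [k >= M] gives [3 ^ k > M], so the added 1 is a relative error below [1 / M]. *)
have [stN cN] := KP (maxn K M) (leq_maxl _ _); set k := maxn K M in stN cN.
have [e' v o] := complexity_expr _ stN.1.
have /(level_nearly _ _ _ _ _ st.1 M0) : nearly a (complexity a) 1 M e'.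
  exists k; rewrite v o cN; split=> //; [lia|lia| ].
  have : (M < 3 ^ k)%N by rewrite (leq_ltn_trans (leq_maxr K M)) // ltn_expl.
  by have := st.1; nia.
rewrite v o => h.
have /closure_epsP/(_ _ e20)[y Sy hy] := IH _ stN; exists y => //.
have := ler_distD (defect R (3 ^ k * a + 1) + m%:R) (defect R a + m.+1%:R) y.
have -> : defect R a + m.+1%:R - (defect R (3 ^ k * a + 1) + m%:R) =
  level a (complexity a + 1) - level (3 ^ k * a + 1) (complexity (3 ^ k * a + 1)).
  by rewrite /defect /level -natr1 natrD; ring.
lra.
Qed.

End RealDefects.

Theorem theorem1p11 (R : realType) :
  [/\ closure (defects R) = closure (stable_defects R),
      closure (stable_defects R) = add_nat (defects R)
    & add_nat (defects R) = add_nat (stable_defects R)].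
Proof.
have sub1 : closure (stable_defects R) `<=` closure (defects R).
  by apply: closure_subset => x [n st <-]; exists n => //; exact: st.1.
have sub2 := @closure_defects_sub R.
have sub3 : add_nat (defects R) `<=` closure (stable_defects R).
  by rewrite stable_add_nat => x [y [a st <-]] [m _ <-]; apply: stable_defect_addn.
split; last exact: stable_add_nat.
- by apply/seteqP; split=> // x /sub2/sub3.
- by apply/seteqP; split=> // x /sub1/sub2.
Qed.
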